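(* Let $f:\mathbb{D}\to\mathbb{D}$ be holomorphic. For $n\ge1$ and $z,w\in\mathbb{D}$, $$c_{f^{\circ n}}(z,w)=\prod_{j=0}^{n-1}c_f\big(f^{\circ j}(z),f^{\circ j}(w)\big).$$ Moreover, $$\Phi_f^{n}=\Phi_{f^{\circ n}}.$$ There is an isometry $$J_{f,n}:\mathcal{H}(f^{\circ n})\longrightarrow\mathcal{H}(f)^{\otimes n}$$ given on kernel functions by $$J_{f,n}\,c_{f^{\circ n},w}=c_{f,f^{\circ(n-1)}(w)}\otimes\cdots\otimes c_{f,f(w)}\otimes c_{f,w},\qquad w\in\mathbb{D}.$$
   Context: All inner products are linear in the second variable. $\mathbb{D}$ is the open unit disk, $H^2$ its Hardy space with Szegő kernel $k(z,w)=\frac{1}{1-z\overline w}$, $k_w=k(\cdot,w)$, so $h(w)=\langle k_w,h\rangle$ for $h\in H^2$. $f^{\circ n}$ is the $n$-fold composition of $f$ with itself, $f^{\circ 0}(z)=z$. For any holomorphic $\phi:\mathbb{D}\to\mathbb{D}$, the kernel $c_\phi(z,w)=\frac{1-\phi(z)\overline{\phi(w)}}{1-z\overline w}$ is positive definite on $\mathbb{D}$; its reproducing kernel Hilbert space is the de Branges-Rovnyak space $\mathcal{H}(\phi)$, and $c_{\phi,w}=c_\phi(\cdot,w)$ are its kernel functions. $V_\phi:H^2\to H^2\otimes\mathcal{H}(\phi)$ is the isometry determined by $V_\phi k_w=k_{\phi(w)}\otimes c_{\phi,w}$, $w\in\mathbb{D}$, and $\Phi_\phi(S)=V_\phi^{*}(S\otimes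 I_{\mathcal{H}(\phi)})V_\phi$ for $S\in B(H^2)$, a normal unital completely positive map. $\Phi_f^n$ is the $n$-fold iterate of $\Phi_f$. *)

(* Defs.v *)
From HB Require Import structures.
From mathcomp Require Export all_boot all_order all_algebra complex.
From mathcomp Require Export all_classical all_reals all_analysis.

Set Implicit Arguments.
Unset Strict Implicit.
Unset Printing Implicit Defensive.

Export Order.TTheory GRing.Theory Num.Theory numFieldNormedType.Exports.

Global Open Scope classical_set_scope.
Global Open Scope complex_scope.
Global Open Scope ring_scope.

(* [R[i]^o] is the complex field seen as a normed module over itself. *)

(* Complex Hilbert spaces; the inner product is linear in its SECOND variable. *)
HB.mixin Record CompleteNormedModule_isHilbert (R : realType) H
    & CompleteNormedModule R[i] H := {
  inner : H -> H -> R[i] ;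
  inner_linear : forall (x : H) (a : R[i]) (y z : H),
    inner x (a *: y + z) = a * inner x y + inner x z ;
  inner_conj : forall x y : H, inner y x = (inner x y)^* ;
  norm_inner : forall x : H, `|x| ^+ 2 = inner x x }.

#[short(type="hilbertType")]
HB.structure Definition Hilbert (R : realType) :=
  { H of CompleteNormedModule R[i] H & CompleteNormedModule_isHilbert R H }.

Section Operators.
Variable R : realType.
Implicit Types H K : hilbertType R.

Definition bounded_operator H K (S : H -> K) : Prop :=
  linear S /\ continuous S.

Definition isometry H K (V : H -> K) : Prop :=
  linear V /\ forall x, `|V x| = `|x|.

(* [xget 0 P] is an element of [P] whenever there is one: here it is used for
   objects that are uniquely determined by [P]. *)
Definition adjoint H K (V : H -> K) : K -> H :=
  xget (fun=> 0) [set A : K -> H | forall x y, inner (A y) x = inner y (V x)].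

Definition lspan H (A : set H) : set H :=
  [set x | exists (m : nat) (a : 'I_m -> R[i]) (v : 'I_m -> H),
     (forall i, A (v i)) /\ x = \sum_(i < m) a i *: v i].

End Operators.

(* The Hilbert space tensor product, which these properties characterize up to
   a unique unitary matching elementary tensors. *)
Record hilbert_tensor (R : realType) (H K : hilbertType R) := HilbertTensor {
  tensor_space :> hilbertType R ;
  tensor : H -> K -> tensor_space ;
  tensor_linear_l : forall y, linear (tensor^~ y) ;
  tensor_linear_r : forall x, linear (tensor x) ;
  inner_tensor : forall x y x' y',
    inner (tensor x y) (tensor x' y') = inner x x' * inner y y' ;
  tensor_total : dense (lspan [set tensor x y | x in [set: H] & y in [set: K]]) }.

Arguments tensor {R H K} _ _ _.

(* The n-fold Hilbert space tensor power; [tensorn T x] is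
   [x 0 (x) ... (x) x (n-1)]. *)
Record hilbert_tensor_power (R : realType) (H : hilbertType R) (n : nat) :=
  HilbertTensorPower {
  tensorn_space :> hilbertType R ;
  tensorn : {ffun 'I_n -> H} -> tensorn_space ;
  tensorn_linear : forall (x : {ffun 'I_n -> H}) (i : 'I_n),
    linear (fun y : H => tensorn [ffun j => if j == i then y else x j]) ;
  inner_tensorn : forall x y : {ffun 'I_n -> H},
    inner (tensorn x) (tensorn y) = \prod_(i < n) inner (x i) (y i) ;
  tensorn_total : dense (lspan (range tensorn)) }.

Arguments tensorn {R H n} _ _.

Section OperatorTensor.
Variables (R : realType) (H K : hilbertType R) (T : hilbert_tensor H K).

(* [S (x) I]. *)
Definition tensor_id (S : H -> H) : T -> T :=
  xget (fun=> 0) [set A : T -> T | bounded_operator A /\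
    forall x y, A (tensor T x y) = tensor T (S x) y].

End OperatorTensor.

Arguments tensor_id {R H K} _ _ _.

Definition disk (R : realType) : set R[i]^o := [set z | `|z| < 1].
Arguments disk {R}.

(* Functions on the disk are represented by functions on [R[i]], only the values
   on the disk being relevant. *)
Definition holomorphic_self_map (R : realType) (f : R[i]^o -> R[i]^o) : Prop :=
  (forall z, disk z -> disk (f z)) /\ (forall z, disk z -> derivable f z 1).

(* Hilbert spaces of functions on the disk. *)
Record function_hilbert (R : realType) := FunctionHilbert {
  function_space :> hilbertType R ;
  feval : function_space -> R[i]^o -> R[i]^o ;
  feval_linear : forall (a : R[i]) (g h : function_space) z, disk z ->
    feval (a *: g + h) z = a * feval g z + feval h z ;
  feval_inj : forall g h : function_space,
    (forall z, disk z -> feval g z = feval h z) -> g = h }.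

Arguments feval {R} _ _ _.

Section Kernels.
Variable R : realType.
Local Notation C := (R[i]^o).
Implicit Types (K : C -> C -> C) (z w : C).

(* The element [K(., w)] of [H]. *)
Definition kernel_at (H : function_hilbert R) K w : H :=
  xget 0 [set k : H | forall z, disk z -> feval H k z = K z w].

Definition has_reproducing_kernel (H : function_hilbert R) K : Prop :=
  forall w, disk w -> exists k : H,
    (forall z, disk z -> feval H k z = K z w) /\
    (forall h : H, feval H h w = inner k h).

Definition szego z w : C := (1 - z * w^*)^-1.

Definition dbr_kernel (phi : C -> C) z w : C :=
  (1 - phi z * (phi w)^*) / (1 - z * w^*).

Definition hardy_coef (a : nat -> C) (g : C -> C) : Prop :=
  cvgn (series (fun m => `|a m| ^+ 2 : C)) /\
  forall z, disk z -> series (fun m => a m * z ^+ m : C) @ \oo --> g z.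

End Kernels.

(* H^2: the power series with square-summable coefficients, with the l^2 inner
   product of the coefficients. *)
Record hardy_space (R : realType) := HardySpace {
  hardy_function_hilbert :> function_hilbert R ;
  hardyP : forall g : R[i]^o -> R[i]^o,
    (exists h : hardy_function_hilbert,
       forall z, disk z -> feval hardy_function_hilbert h z = g z) <->
    (exists a : nat -> R[i]^o, hardy_coef a g) ;
  inner_hardy : forall (g h : hardy_function_hilbert) (a b : nat -> R[i]^o),
    hardy_coef a (feval hardy_function_hilbert g) ->
    hardy_coef b (feval hardy_function_hilbert h) ->
    series (fun m => (a m)^* * b m : R[i]^o) @ \oo --> (inner g h : R[i]^o) }.

(* The de Branges-Rovnyak space of [phi]. *)
Record dbr_space (R : realType) (phi : R[i]^o -> R[i]^o) := DbrSpace {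
  dbr_function_hilbert :> function_hilbert R ;
  dbr_reproducing :
    has_reproducing_kernel dbr_function_hilbert (dbr_kernel phi) }.

Section Transfer.
Variables (R : realType) (phi : R[i]^o -> R[i]^o).
Variables (H2 : hardy_space R) (Hphi : dbr_space phi).
Variable T : hilbert_tensor H2 Hphi.

Definition dbr_isometry : H2 -> T :=
  xget (fun=> 0) [set V : H2 -> T | isometry V /\
    forall w, disk w ->
      V (kernel_at H2 (@szego R) w) =
      tensor T (kernel_at H2 (@szego R) (phi w))
               (kernel_at Hphi (dbr_kernel phi) w)].

Definition dbr_cp_map (S : H2 -> H2) : H2 -> H2 :=
  adjoint dbr_isometry \o tensor_id T S \o dbr_isometry.

End Transfer.

Arguments dbr_isometry {R phi H2 Hphi} _ _.
Arguments dbr_cp_map {R phi H2 Hphi} _ _ _.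

(* Main.v *)
From HB Require Import structures.
Require Import Defs.
From mathcomp Require Import ring.

(* The kernel identity telescopes. Matrix coefficients against Szego kernels give
   [<k_z, Phi_f(S) k_w> = c_f(z,w) <k_(f z), S k_(f w)>], so iterating produces the
   product of the [c_f(f^j z, f^j w)], that is [c_(f^n)(z,w)]: [Phi_f^n(S)] and
   [Phi_(f^n)(S)] have the same coefficients on the total family of kernels. The
   product formula also says that the kernels of [H(f^n)] and their prescribed
   images under [J] have the same Gram matrix, so [J] extends to an isometry. *)

Set Implicit Arguments.
Unset Strict Implicit.
Unset Printing Implicit Defensive.

(** * Hilbert space geometry *)

Section InnerProduct.
Variables (R : realType) (H : hilbertType R).
Implicit Types (x y z : H) (a : R[i]).

Lemma innerDr x y z : inner x (y + z) = inner x y + inner x z.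
Proof. by have := inner_linear x 1 y z; rewrite scale1r mul1r. Qed.

Lemma inner0r x : inner x 0 = 0.
Proof. by have := inner_linear x (-1) 0 0; rewrite scaleN1r addNr mulN1r addNr. Qed.

Lemma innerZr a x y : inner x (a *: y) = a * inner x y.
Proof. by have := inner_linear x a y 0; rewrite inner0r !addr0. Qed.

Lemma innerNr x y : inner x (- y) = - inner x y.
Proof. by rewrite -scaleN1r innerZr mulN1r. Qed.

Lemma innerBr x y z : inner x (y - z) = inner x y - inner x z.
Proof. by rewrite innerDr innerNr. Qed.

Lemma innerDl x y z : inner (x + y) z = inner x z + inner y z.
Proof. by rewrite inner_conj innerDr rmorphD /= -!inner_conj. Qed.

Lemma inner0l x : inner 0 x = 0.
Proof. by rewrite inner_conj inner0r rmorph0. Qed.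

Lemma innerZl a x y : inner (a *: x) y = a^* * inner x y.
Proof. by rewrite inner_conj innerZr rmorphM /= -inner_conj. Qed.

Lemma innerNl x y : inner (- x) y = - inner x y.
Proof. by rewrite inner_conj innerNr rmorphN /= -inner_conj. Qed.

Lemma innerBl x y z : inner (x - y) z = inner x z - inner y z.
Proof. by rewrite innerDl innerNl. Qed.

Lemma inner_suml I (s : seq I) (u : I -> H) y :
  inner (\sum_(i <- s) u i) y = \sum_(i <- s) inner (u i) y.
Proof.
by apply: (big_morph (inner^~ y)) => [x z|]; [exact: innerDl|exact: inner0l].
Qed.

Lemma inner_sumr I (s : seq I) (u : I -> H) y :
  inner y (\sum_(i <- s) u i) = \sum_(i <- s) inner y (u i).
Proof.
by apply: (big_morph (inner y)) => [x z|]; [exact: innerDr|exact: inner0r].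
Qed.

Lemma inner_eq0 x : inner x x = 0 -> x = 0.
Proof. by rewrite -norm_inner => /eqP; rewrite expf_eq0 /= normr_eq0 => /eqP. Qed.

Lemma inner_ext x y : (forall z, inner z x = inner z y) -> x = y.
Proof.
by move=> xy; apply/eqP; rewrite -subr_eq0; apply/eqP/inner_eq0; rewrite innerBr xy subrr.
Qed.

(* The value at the minimum over [t : C] of the quadratic polynomial [|x - t y|^2]. *)
Lemma norm_sub_proj x y : y != 0 ->
  `|x - (inner y x / inner y y) *: y| ^+ 2 =
  `|x| ^+ 2 - `|inner y x| ^+ 2 / `|y| ^+ 2.
Proof.
move=> y0.
have yy0 : inner y y != 0 by apply: contra_neq y0; exact: inner_eq0.
rewrite !norm_inner normCK -(inner_conj y x) [inner x y]inner_conj.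
rewrite innerBl innerBr innerZl innerBr !innerZr rmorphM fmorphV /=.
rewrite -(inner_conj y y) [inner x y]inner_conj.
by field.
Qed.

Lemma cauchy_schwarz x y : `|inner x y| <= `|x| * `|y|.
Proof.
have [->|x0] := eqVneq x 0; first by rewrite inner0l !normr0 mul0r.
have x2 : 0 < `|x| ^+ 2 by rewrite exprn_gt0 ?normr_gt0.
rewrite -(@ler_pXn2r _ 2) ?nnegrE ?mulr_ge0// exprMn mulrC -ler_pdivrMr//.
by rewrite -subr_ge0 -norm_sub_proj// exprn_ge0.
Qed.

Lemma pythagoras x y : inner x y = 0 -> `|x + y| ^+ 2 = `|x| ^+ 2 + `|y| ^+ 2.
Proof.
move=> xy; rewrite !norm_inner innerDl !innerDr xy (inner_conj x y) xy.
by rewrite rmorph0 addr0 add0r.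
Qed.

Lemma parallelogram x y :
  `|x + y| ^+ 2 + `|x - y| ^+ 2 = 2 * `|x| ^+ 2 + 2 * `|y| ^+ 2.
Proof. by rewrite !norm_inner !innerDl !innerDr !innerNl !innerNr; ring. Qed.

End InnerProduct.

Section Complete.
Variables (R : realType) (H : completeNormedModType R[i]).
Implicit Types (B : R[i] -> set H).

(** The order on [R[i]] is partial, but positive elements are real and therefore comparable. *)
Lemma gt0_min (a b : R[i]) : 0 < a -> 0 < b ->
  exists2 c, 0 < c & c <= a /\ c <= b.
Proof.
move=> a0 b0; have /orP[ab|ba] := real_leVge (gtr0_real a0) (gtr0_real b0).
  by exists a.
by exists b.
Qed.

(** The sets [B e] form a base of a proper Cauchy filter. Its limit replaces that of a minimizing or
    approximating sequence, so no sequence has to be chosen. *)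
Lemma cauchy_family_limit B :
  (forall e, 0 < e -> B e !=set0) ->
  (forall e e', 0 < e -> e <= e' -> B e `<=` B e') ->
  (forall e, 0 < e -> exists2 d, 0 < d &
     forall x y, B d x -> B d y -> `|x - y| < e) ->
  exists l : H, forall e d, 0 < e -> 0 < d -> exists2 x, B d x & `|l - x| < e.
Proof.
move=> B0 Bmono Bcauchy.
pose F := filter_from [set e : R[i] | 0 < e] B.
have FF : Filter F.
  apply: filter_from_filter; first by exists 1 => /=.
  move=> a b /= a0 b0; have [c c0 [ca cb]] := gt0_min a0 b0.
  by exists c => // x Bx; split; exact: Bmono Bx.
have PF : ProperFilter F by exact: filter_from_proper.
have Fc : cauchy F.
  apply: cauchy_exP => e e0; have [d d0 Bd] := Bcauchy e e0.
  have [x Bx] := B0 d d0; exists x; exists d => // y By.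
  by rewrite -ball_normE /=; exact: Bd.
have [l Fl] := (cvg_ex F).1 (cauchy_cvg F Fc).
exists l => e d e0 d0.
have Fe : F (ball l e) by apply: Fl; exact: nbhsx_ballx.
have Fd : F (B d) by exists d.
have [x [le Bx]] := @filter_ex _ _ PF _ (filterI Fe Fd).
by exists x => //; move: le; rewrite -ball_normE.
Qed.

End Complete.

Lemma ge0_infinitesimal (F : numFieldType) (c b : F) :
  0 <= c -> 0 <= b -> (forall e, 0 < e -> c <= e * b) -> c = 0.
Proof.
move=> c0 b0 cb; apply/eqP; apply: contraT => cN0.
have {c0 cN0} c0 : 0 < c by rewrite lt_def cN0.
have b1 : 0 < b + 1 by rewrite ltr_wpDl.
(* With [e = c / (b + 1)] the hypothesis becomes [c * (b + 1) <= c * b], absurd for [c > 0]. *)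
have := cb _ (divr_gt0 c0 b1).
rewrite mulrAC ler_pdivlMr// ler_pM2l// => h.
by move: h; rewrite gerDl ler10.
Qed.

(** * Vectors orthogonal to a subspace *)

Section Projection.
Variables (R : realType) (H : hilbertType R).
Implicit Types (x y z : H) (L : set H).

Lemma inf_dist2 L x : L !=set0 -> exists2 d : R[i],
  (forall l, L l -> d <= `|x - l| ^+ 2) &
  (forall e, 0 < e -> exists2 l, L l & `|x - l| ^+ 2 < d + e).
Proof.
move=> [l0 Ll0].
pose r l : R := complex.Re (`|x - l| ^+ 2).
have rE l : (r l)%:C = `|x - l| ^+ 2.
  by rewrite RRe_real// ger0_real// exprn_ge0.
have r0 l : 0 <= r l by rewrite -lecR rE exprn_ge0.
pose E := [set r l | l in L].
have Elb : has_lbound E by exists 0 => _ [l _ <-].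
exists (inf E)%:C => [l Ll|e e0].
  by rewrite -rE lecR; apply: ge_inf => //; exists l.
have eE : (complex.Re e)%:C = e by rewrite RRe_real// gtr0_real.
have [||_ [l Ll <-] re] := @inf_adherent _ E (complex.Re e).
- by rewrite -ltcR eE.
- by split=> //; exists (r l0), l0.
by exists l => //; rewrite -rE -eE -rmorphD ltcR.
Qed.

(** Near-minimizers of the distance from [x] to [L] converge to a point [p] of the closure of [L],
    and [z = x - p] works: it is nonzero because [x] stays at distance [e] from [L], and orthogonal
    to [L] by minimality. *)
Lemma orthogonal_vector L x (e : R[i]) : L 0 ->
  (forall a u v, L u -> L v -> L (a *: u + v)) ->
  0 < e -> (forall l, L l -> e <= `|x - l|) ->
  exists2 z, z != 0 & forall l, L l -> inner l z = 0.
Proof.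
move=> L0 Llin e0 Le.
have [d dle dlt] := @inf_dist2 L x (ex_intro _ _ L0).
pose B (e : R[i]) := [set l | L l /\ `|x - l| ^+ 2 < d + e].
have BC t : 0 < t -> exists2 s, 0 < s &
    forall l l', B s l -> B s l' -> `|l - l'| < t.
  (* By the parallelogram law and the bound [d] at the midpoint,
     [|l - l'|^2 < 4 (d + s) - 4 d = 4 s], whence [s = t^2 / 4]. The [+ 0] below puts the midpoint
     in the shape required by [Llin]. *)
  move=> t0; exists (t ^+ 2 / 4); first by rewrite divr_gt0 ?exprn_gt0.
  move=> l l' [Ll xl] [Ll' xl'].
  rewrite -(@ltr_pXn2r _ 2) ?nnegrE ?(ltW t0)//.
  have := parallelogram (x - l) (x - l').
  rewrite (_ : x - l - (x - l') = l' - l); last by rewrite opprB addrC addrA subrK.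
  rewrite (_ : x - l + (x - l') = 2 *: (x - (2^-1 *: (l + l') + 0))); last first.
    rewrite addr0 scalerBr scalerA divff ?scale1r ?pnatr_eq0//.
    by rewrite addrACA -opprD scaler_nat mulr2n.
  have Lm : L (2^-1 *: (l + l') + 0).
    by apply: (Llin) => //; rewrite -[l]scale1r; exact: Llin.
  rewrite normrZ exprMn (distrC l') ger0_norm// => E.
  rewrite (_ : `|l - l'| ^+ 2 = 2 * `|x - l| ^+ 2 + 2 * `|x - l'| ^+ 2
    - 2 ^+ 2 * `|x - (2^-1 *: (l + l') + 0)| ^+ 2); last by rewrite -E addrAC subrr add0r.
  apply: (@lt_le_trans _ _ (2 * (d + t ^+ 2 / 4) + 2 * (d + t ^+ 2 / 4) - 2 ^+ 2 * d)).
    by apply: ltr_leB; [apply: ltrD; rewrite ltr_pM2l|rewrite ler_pM2l ?dle ?exprn_gt0].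
  by rewrite le_eqVlt; apply/orP; left; apply/eqP; field.
have [||p Bp] := cauchy_family_limit _ _ BC.
- by move=> s /dlt[l ? ?]; exists l.
- by move=> s t s0 st l [Ll ls]; split=> //; apply: (lt_le_trans ls); rewrite lerD2l.
exists (x - p).
  apply/eqP => /eqP; rewrite subr_eq0 => /eqP xp.
  have [l [Ll _]] := Bp e 1 e0 ltr01.
  by rewrite -xp => /(le_lt_trans (Le l Ll)); rewrite ltxx.
move=> v Lv; have [->|v0] := eqVneq v 0; first by rewrite inner0l.
apply/normr0_eq0.
apply: (@ge0_infinitesimal _ _ (2 * `|v|)) => // s s0.
(* Both terms of [x - p = (x - l) + (l - p)] should contribute at most [s * |v|]: the second since
   [l] is within [s] of [p], the first since [l] minimizes up to [s^2]. *)
have [l [Ll xl] lp] := Bp s (s ^+ 2) s0 (exprn_gt0 2 s0).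
rewrite (_ : x - p = (x - l) + (l - p)); last by rewrite addrA subrK.
rewrite innerDr (le_trans (ler_normD _ _))// mulrCA mulrDl mul1r lerD//; last first.
  rewrite (le_trans (cauchy_schwarz _ _))// mulrC ler_wpM2r// distrC ltW//.
have v2 : 0 < `|v| ^+ 2 by rewrite exprn_gt0 ?normr_gt0.
rewrite -(@ler_pXn2r _ 2) ?nnegrE ?mulr_ge0 ?(ltW s0)// exprMn -ler_pdivrMr//.
(* Moving [l] inside [L] by the projection of [x - l] on [v] lowers the squared distance by
   [|<v, x - l>|^2 / |v|^2], yet not below [d]; the drop is thus less than [s^2]. *)
have := norm_sub_proj (x - l) v0; rewrite -[x - l - _]addrA -opprD [l + _]addrC => E.
have := dle _ (Llin (inner v (x - l) / inner v v) _ _ Lv Ll).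
rewrite E lerBrDr => h; have := le_lt_trans h xl.
by rewrite ltrD2l => /ltW.
Qed.

End Projection.

(** * Bounded operators, adjoints and extension by density *)

Section BoundedOperators.
Variables (R : realType).
Implicit Types (H K : hilbertType R).

Lemma linear_bundle (U V : lmodType R[i]) (f : U -> V) :
  linear f -> exists g : {linear U -> V}, g =1 f.
Proof.
move=> lf.
pose mixin := GRing.isLinear.Build _ _ _ _ f lf.
pose g : {linear U -> V} := HB.pack f mixin.
by exists g.
Qed.

Lemma bounded_operatorP H K (S : H -> K) : bounded_operator S <->
  linear S /\ exists2 M : R[i], 0 < M & forall x, `|S x| <= M * `|x|.
Proof.
split=> -[lS].
  have [g /funext <-] := linear_bundle lS.
  move=> /linear_bounded_continuous/linear_boundedP Sr; split; first exact: linearP.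
  have [M M0 SM] := pinfty_ex_gt (real0 _) Sr.
  by exists M.
have [g /funext <-] := linear_bundle lS.
move=> [M M0 SM]; split; first exact: linearP.
apply/linear_bounded_continuous/linear_boundedP.
near=> r => x; apply: (le_trans (SM x)); apply: ler_wpM2r => //.
by near: r; apply: nbhs_pinfty_ge; exact: gtr0_real.
Unshelve. all: by end_near. Qed.

Lemma isometry_bounded H K (V : H -> K) : isometry V -> bounded_operator V.
Proof.
by move=> [lV nV]; apply/bounded_operatorP; split=> //; exists 1 => // x; rewrite nV mul1r.
Qed.

(** A nonzero [phi] is represented by a multiple of a vector [z] orthogonal to its null space, since
    each [x] differs from a multiple of [z] by a null vector. *)
Lemma riesz H (phi : H -> R[i]) (M : R[i]) :
  (forall a x y, phi (a *: x + y) = a * phi x + phi y) ->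
  0 < M -> (forall x, `|phi x| <= M * `|x|) ->
  exists a, forall x, phi x = inner a x.
Proof.
move=> lphi M0 phiM.
have phi0 : phi 0 = 0 by have := lphi (-1) 0 0; rewrite scaler0 addr0 mulN1r addNr.
have [phi_eq0|] := pselect (forall x, phi x = 0).
  by exists 0 => x; rewrite inner0l.
move=> /existsNP[x0 /eqP x0N0].
(* For [l] in the null space, [|phi x0| = |phi (x0 - l)| <= M * |x0 - l|], which gives the
   distance. *)
have [|||l Ll|z z0 zL] := @orthogonal_vector _ _ [set x | phi x = 0] x0 (`|phi x0| / M).
- exact: phi0.
- by move=> a u v /= u0 v0; rewrite lphi u0 v0 mulr0 addr0.
- by rewrite divr_gt0 ?normr_gt0.
- rewrite ler_pdivrMr// mulrC (_ : phi x0 = phi (x0 - l)) ?phiM//.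
  by rewrite -[x0 - l]addrC -scaleN1r lphi Ll mulr0 add0r.
have zz0 : inner z z != 0 by apply: contra_neq z0; exact: inner_eq0.
have phiz0 : phi z != 0.
  by apply: contra_neq zz0 => ?; exact: zL.
exists (((phi z / inner z z)^*) *: z) => x.
rewrite innerZl conjCK.
have /zL lz0 : phi (- (phi x / phi z) *: z + x) = 0 by rewrite lphi mulNr divfK// addNr.
have : inner z (- (phi x / phi z) *: z + x) = 0 by rewrite inner_conj lz0 rmorph0.
rewrite innerDr innerZr addrC mulNr => /eqP; rewrite subr_eq0 => /eqP ->.
by rewrite mulrCA !divfK.
Qed.

Lemma adjointP H K (V : H -> K) : bounded_operator V ->
  forall x y, inner (adjoint V y) x = inner y (V x).
Proof.
move=> /bounded_operatorP[lV [M M0 VM]].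
suff eA : exists A : K -> H, forall x y, inner (A y) x = inner y (V x).
  exact: (xgetPex (fun=> 0) eA).
suff /choice[A hA] : forall y, exists a, forall x, inner a x = inner y (V x).
  by exists A => x y; rewrite hA.
(* The summand 1 keeps the constant positive when [y = 0]. *)
move=> y; have [|||a ha] := @riesz H (fun x => inner y (V x)) ((`|y| + 1) * M).
- by move=> a u v; rewrite lV inner_linear.
- by rewrite mulr_gt0// ltr_wpDl.
- move=> x; rewrite (le_trans (cauchy_schwarz _ _))// -mulrA.
  by rewrite ler_pM// lerDl.
by exists a.
Qed.

(** With [A] the adjoint, [|A x|^2 = <x, V (A x)> <= |x| * M * |A x|], and one factor [|A x|]
    cancels. *)
Lemma adjoint_bounded H K (V : H -> K) :
  bounded_operator V -> bounded_operator (adjoint V).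
Proof.
move=> bV; have [_ [M M0 VM]] := (bounded_operatorP V).1 bV.
apply/bounded_operatorP; split.
  move=> a x y; apply: inner_ext => z.
  by rewrite inner_conj adjointP// innerDr innerZr [inner z (_ x)]inner_conj
     [inner z (_ y)]inner_conj !adjointP// innerDl innerZl rmorphD rmorphM /= conjCK.
exists M => // x; have [->|Ax0] := eqVneq (adjoint V x) 0.
  by rewrite normr0 mulr_ge0 ?(ltW M0).
rewrite -(@ler_pM2l _ `|adjoint V x|) ?normr_gt0// -expr2.
have -> : `|adjoint V x| ^+ 2 = `|inner x (V (adjoint V x))|.
  by rewrite -adjointP// -norm_inner normrX normr_id.
rewrite (le_trans (cauchy_schwarz _ _))//.
by rewrite [leRHS]mulrC mulrAC [leRHS]mulrC ler_wpM2l.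
Qed.

Definition adherent H K (G : H -> K -> Prop) x y :=
  forall e : R[i], 0 < e -> exists p q, [/\ G p q, `|x - p| < e & `|y - q| < e].

(* The extension is the closure of the graph [G], whence the adherent pairs. *)
Lemma dense_extension H K (G : H -> K -> Prop) (M : R[i]) :
  G 0 0 ->
  (forall a p q p' q', G p q -> G p' q' -> G (a *: p + p') (a *: q + q')) ->
  0 < M -> (forall p q, G p q -> `|q| <= M * `|p|) ->
  (forall x (e : R[i]), 0 < e -> exists p q, G p q /\ `|x - p| < e) ->
  exists A : H -> K, [/\ linear A, forall x, `|A x| <= M * `|x| &
    forall p q, G p q -> A p = q].
Proof.
move=> G0 Glin M0 GM Gdense.
have bound x y : adherent G x y -> `|y| <= M * `|x|.
  move=> xy; apply/ler_addgt0Pr => e e0.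
  have M1 : 0 < 1 + M by rewrite addr_gt0.
  (* The error in [q] costs [e / (1 + M)] and the one in [p] costs [M] times as much, [e] in
     total. *)
  have [p [q [Gpq xp yq]]] := xy _ (divr_gt0 e0 M1).
  rewrite -(subrK q y) (le_trans (ler_normD _ _))//.
  apply: (@le_trans _ _ (e / (1 + M) + M * (`|x| + e / (1 + M)))).
    apply: lerD; first exact: ltW.
    rewrite (le_trans (GM _ _ Gpq))// ler_pM2l// -(subrK x p).
    by rewrite (le_trans (ler_normD _ _))// addrC lerD2l distrC ltW.
  rewrite le_eqVlt; apply/orP; left; apply/eqP.
  by field; rewrite gt_eqF.
have adhlin a x y x' y' : adherent G x y -> adherent G x' y' ->
    adherent G (a *: x + x') (a *: y + y').
  move=> xy xy' e e0; have a1 : 0 < `|a| + 1 by rewrite ltr_wpDl.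
  have [p [q [Gpq xp yq]]] := xy _ (divr_gt0 e0 a1).
  have [p' [q' [Gpq' xp' yq']]] := xy' _ (divr_gt0 e0 a1).
  have close (V : normedModType R[i]) (u v u' v' : V) :
      `|u - v| < e / (`|a| + 1) -> `|u' - v'| < e / (`|a| + 1) ->
      `|a *: u + u' - (a *: v + v')| < e.
    move=> uv uv'; rewrite opprD addrACA -scalerBr (le_lt_trans (ler_normD _ _))//.
    rewrite normrZ [ltRHS](_ : e = `|a| * (e / (`|a| + 1)) + e / (`|a| + 1)).
      by rewrite ler_ltD// ler_wpM2l// ltW.
    by field; rewrite gt_eqF.
  by exists (a *: p + p'), (a *: q + q'); split; [exact: Glin|exact: close|exact: close].
have /choice[A GA] : forall x, exists y, adherent G x y.
  move=> x; pose B (e : R[i]) := [set q | exists2 p, G p q & `|x - p| < e].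
  have [|||y By] := @cauchy_family_limit _ _ B.
  - by move=> e /(Gdense x)[p [q [? ?]]]; exists q, p.
  - by move=> e e' e0 ee' q [p Gpq pe]; exists p => //; exact: lt_le_trans ee'.
  - move=> e e0; exists (e / (2 * M)); first by rewrite divr_gt0// mulr_gt0.
    move=> q q' [p Gpq xp] [p' Gpq' xp'].
    have : G (-1 *: p' + p) (-1 *: q' + q) by exact: Glin.
    rewrite !scaleN1r [- p' + _]addrC [- q' + _]addrC => /GM/le_lt_trans; apply.
    rewrite mulrC -ltr_pdivlMr// (_ : p - p' = (x - p') - (x - p)); last first.
      by rewrite opprB [RHS]addrC addrA subrK.
    rewrite (le_lt_trans (ler_normB _ _))//.
    have -> : e / M = e / (2 * M) + e / (2 * M) by field; rewrite gt_eqF.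
    exact: ltrD.
  exists y => e e0; have [q [p Gpq xp] yq] := By e e e0 e0.
  by exists p, q.
(* Subtracting two adherent pairs over the same [x] gives an adherent pair over 0, whose second
   member vanishes by [bound]. *)
have uniq x y : adherent G x y -> A x = y.
  move=> xy; have := adhlin (-1) _ _ _ _ xy (GA x).
  move=> /bound; rewrite !scaleN1r !addNr normr0 mulr0 normr_le0 addrC subr_eq0.
  by move/eqP.
exists A; split=> [a x y|x|p q Gpq].
- by apply: uniq; exact: adhlin.
- exact: bound.
- by apply: uniq => e e0; exists p, q; rewrite !subrr !normr0.
Qed.

End BoundedOperators.

Section Extensions.
Variables (R : realType).
Implicit Types (H K : hilbertType R).

(** A point at positive distance from [L] would yield, by [orthogonal_vector], a nonzero vector
    orthogonal to [L]. *)
Lemma trivial_orthogonal_dense H (L : set H) : L 0 ->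
  (forall a u v, L u -> L v -> L (a *: u + v)) ->
  (forall z, (forall l, L l -> inner l z = 0) -> z = 0) ->
  forall x (e : R[i]), 0 < e -> exists2 l, L l & `|x - l| < e.
Proof.
move=> L0 Llin Lperp x e e0; apply: contrapT => nL.
have [|z z0 zL] := @orthogonal_vector _ _ L x e L0 Llin e0.
  move=> l Ll; rewrite real_leNgt ?(gtr0_real e0) ?normr_real//.
  by apply/negP => xl; apply: nL; exists l.
by case/eqP: z0; exact: Lperp.
Qed.

(** Combinations of the [e i] and of the [e' i] with equal coefficients have equal norms, as these
    depend only on the Gram matrix. This relation extends by density to all of [H]; passing through
    a relation settles well-definedness too. *)
Lemma gram_isometry H K I (e : I -> H) (e' : I -> K) :
  (forall i j, inner (e i) (e j) = inner (e' i) (e' j)) ->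
  (forall z, (forall i, inner (e i) z = 0) -> z = 0) ->
  exists V : H -> K, isometry V /\ forall i, V (e i) = e' i.
Proof.
move=> gram total.
pose comb (W : hilbertType R) (u : I -> W) (s : seq (R[i] * I)) :=
  \sum_(c <- s) c.1 *: u c.2.
pose G p q := exists2 s, p = comb H e s & q = comb K e' s.
have comb1 (W : hilbertType R) (u : I -> W) i : comb W u [:: (1, i)] = u i.
  by rewrite /comb big_seq1 scale1r.
have Glin a p q p' q' : G p q -> G p' q' -> G (a *: p + p') (a *: q + q').
  have comblin (W : hilbertType R) (u : I -> W) s s' :
      a *: comb W u s + comb W u s' = comb W u ([seq (a * c.1, c.2) | c <- s] ++ s').
    rewrite /comb big_cat big_map scaler_sumr /=; congr (_ + _).
    by apply: eq_bigr => c _; rewrite scalerA.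
  move=> [s -> ->] [s' -> ->]; rewrite !comblin.
  by exists ([seq (a * c.1, c.2) | c <- s] ++ s').
have Gnorm p q : G p q -> `|q| = `|p|.
  have combnorm (W : hilbertType R) (u : I -> W) s : `|comb W u s| ^+ 2 =
      \sum_(c <- s) \sum_(d <- s) c.1^* * d.1 * inner (u c.2) (u d.2).
    rewrite norm_inner inner_suml; apply: eq_bigr => c _.
    rewrite inner_sumr; apply: eq_bigr => d _.
    by rewrite innerZl innerZr mulrA.
  move=> [s -> ->]; apply/eqP.
  rewrite -(@eqrXn2 _ 2)// !combnorm; apply/eqP.
  by apply: eq_bigr => c _; apply: eq_bigr => d _; rewrite gram.
have G0 : G 0 0 by exists [::]; rewrite /comb big_nil.
have Gdense x (d : R[i]) : 0 < d -> exists p q, G p q /\ `|x - p| < d.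
  move=> d0.
  have [|||p [q Gpq] xp] := @trivial_orthogonal_dense H [set p | exists q, G p q] _ _ _ x d d0.
  - by exists 0.
  - by move=> a u v [q Gq] [q' Gq']; exists (a *: q + q'); exact: Glin.
  - move=> z zG; apply: total => i; apply: zG; exists (e' i).
    by exists [:: (1, i)]; rewrite comb1.
  by exists p, q.
have [|V [lV Vle VG]] := dense_extension G0 Glin ltr01 _ Gdense.
  by move=> p q /Gnorm ->; rewrite mul1r.
exists V; split; last first.
  by move=> i; apply: VG; exists [:: (1, i)]; rewrite comb1.
split=> // x; apply/eqP; rewrite eq_le; apply/andP; split.
  by have := Vle x; rewrite mul1r.
(* For [|x| <= |V x|], replace [x] by a combination [p], on which norms agree; the replacement is
   paid once on each side, hence [d / 2]. *)
apply/ler_addgt0Pr => d d0.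
have [p [q [Gpq xp]]] := Gdense x (d / 2) (divr_gt0 d0 (ltr0Sn _ 1)).
have [V' V'E] := linear_bundle lV.
rewrite -[leLHS](subrK `|p|) (le_trans (lerD (lerB_dist _ _) (lexx _)))//.
have -> : `|p| = `|V x - V (x - p)|.
  by rewrite -!V'E -linearB opprB addrC subrK V'E (VG _ _ Gpq) (Gnorm _ _ Gpq).
rewrite (le_trans (lerD (lexx _) (ler_normB _ _)))// addrCA lerD2l.
have Vxp : `|V (x - p)| <= `|x - p| by have := Vle (x - p); rewrite mul1r.
rewrite [leRHS](_ : d = d / 2 + d / 2); last by field.
by rewrite lerD// ?ltW// (le_lt_trans Vxp).
Qed.

End Extensions.

(** * The operator [S (x) I] *)

Section TensorId.
Variables (R : realType) (H K : hilbertType R) (T : hilbert_tensor H K).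
Implicit Types (x : H) (y : K) (S : {linear H -> H}) (s t : seq (H * K)).

Lemma tensorDl x x' y : tensor T (x + x') y = tensor T x y + tensor T x' y.
Proof. by have := tensor_linear_l T y 1 x x'; rewrite /= !scale1r. Qed.

Lemma tensorZl a x y : tensor T (a *: x) y = a *: tensor T x y.
Proof.
have t0 : tensor T 0 y = 0.
  by have := tensor_linear_l T y (-1) 0 0; rewrite /= !scaleN1r !addNr.
by have := tensor_linear_l T y a x 0; rewrite /= t0 !addr0.
Qed.

Lemma tensorDZr x a y y' : tensor T x (a *: y + y') = a *: tensor T x y + tensor T x y'.
Proof. exact: tensor_linear_r. Qed.

(** A list encodes a representation of a vector as a sum of elementary tensors: [S = idfun] gives
    the vector, a general [S] its intended image under [tensor_id T S]. *)
Definition tensor_sum (S : H -> H) s : T := \sum_(c <- s) tensor T (S c.1) c.2.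

Lemma tensor_sum_cons (S : H -> H) c s :
  tensor_sum S (c :: s) = tensor T (S c.1) c.2 + tensor_sum S s.
Proof. by rewrite /tensor_sum big_cons. Qed.

Lemma tensor_sum_linear S a s s' :
  a *: tensor_sum S s + tensor_sum S s' =
  tensor_sum S ([seq (a *: c.1, c.2) | c <- s] ++ s').
Proof.
rewrite /tensor_sum big_cat big_map scaler_sumr /=; congr (_ + _).
by apply: eq_bigr => c _; rewrite linearZ tensorZl.
Qed.

Definition orthogonal_legs s :=
  pairwise (fun u v : K => inner u v == 0) (map snd s).

Lemma orthogonal_sym (u v : K) : inner u v = 0 -> inner v u = 0.
Proof. by rewrite (inner_conj u v) => ->; rewrite rmorph0. Qed.

(** Moving [a *: y0] out of the new leg is compensated by adding [a *: x] to the first leg paired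
    with [y0]. The second legs of [t] are kept, and the rewriting uses only linearity, so it holds
    for every [S] at once. *)
Lemma orthogonalize_leg x y t : orthogonal_legs t ->
  exists y' t', [/\ map snd t' = map snd t,
    all (fun v => inner y' v == 0) (map snd t) &
    forall S, tensor_sum S ((x, y) :: t) = tensor_sum S ((x, y') :: t')].
Proof.
elim: t => [|[x0 y0] t IH] /=; first by move=> _; exists y, [::].
rewrite /orthogonal_legs /= => /andP[y0t /IH[y' [t' [t't y't E]]]].
(* Projection coefficient on [y0]; it is 0 by the convention on inverses when [y0 = 0]. *)
pose a := inner y0 y' / inner y0 y0.
exists (y' - a *: y0), ((x0 + a *: x, y0) :: t'); split=> [|/=|S].
- by rewrite /= t't.
- apply/andP; split; last first.
    apply/allP => v vt; rewrite innerBl innerZl (eqP (allP y't v vt)).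
    by rewrite (eqP (allP y0t v vt)) mulr0 subr0.
  apply/eqP/orthogonal_sym; rewrite innerBr innerZr.
  have [->|y00] := eqVneq y0 0; first by rewrite !inner0l mulr0 subr0.
  by rewrite divfK ?subrr//; apply: contra_neq y00; exact: inner_eq0.
- move: (E S); rewrite !tensor_sum_cons /= addrCA => ->.
  have -> : S (x0 + a *: x) = a *: S x + S x0 by rewrite addrC linearP.
  have -> : y' - a *: y0 = (- a) *: y0 + y' by rewrite addrC scaleNr.
  rewrite tensorDl tensorZl tensorDZr scaleNr.
  by rewrite [- _ + _]addrC !addrA subrK; congr (_ + _); exact: addrC.
Qed.

(* Gram-Schmidt on the second legs; it reduces the norm bound of [S (x) I] to
   Pythagoras' theorem. *)
Lemma orthogonalize_legs s : exists t, orthogonal_legs t /\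
  forall S, tensor_sum S s = tensor_sum S t.
Proof.
elim: s => [|[x y] s [t [ot E]]]; first by exists [::].
have [y' [t' [t't y't E']]] := orthogonalize_leg x y ot.
exists ((x, y') :: t'); split; first by rewrite /orthogonal_legs /= t't y't.
by move=> S; rewrite -E' !tensor_sum_cons E.
Qed.

Lemma norm_tensor x y : `|tensor T x y| ^+ 2 = `|x| ^+ 2 * `|y| ^+ 2.
Proof. by rewrite !norm_inner inner_tensor. Qed.

Lemma norm_tensor_sum (S : H -> H) t : orthogonal_legs t ->
  `|tensor_sum S t| ^+ 2 = \sum_(c <- t) `|S c.1| ^+ 2 * `|c.2| ^+ 2.
Proof.
elim: t => [_|c t IH]; first by rewrite /tensor_sum !big_nil normr0 expr0n.
rewrite /orthogonal_legs /= => /andP[ct /IH{}IH].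
rewrite tensor_sum_cons big_cons pythagoras ?IH ?norm_tensor//.
rewrite inner_sumr big1_seq// => d /andP[_ dt].
by rewrite inner_tensor (eqP (allP ct _ (map_f snd dt))) mulr0.
Qed.

Lemma tensor_idP (S : H -> H) : bounded_operator S ->
  bounded_operator (tensor_id T S) /\
  forall x y, tensor_id T S (tensor T x y) = tensor T (S x) y.
Proof.
move=> /bounded_operatorP[lS [M M0 SM]].
suff eA : exists A : T -> T, bounded_operator A /\
    forall x y, A (tensor T x y) = tensor T (S x) y.
  exact: (xgetPex (fun=> 0) eA).
have [S' /funext S'E] := linear_bundle lS.
pose G p q := exists2 s, p = tensor_sum (idfun : {linear H -> H}) s & q = tensor_sum S' s.
have Glin a p q p' q' : G p q -> G p' q' -> G (a *: p + p') (a *: q + q').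
  move=> [s -> ->] [s' -> ->]; rewrite !tensor_sum_linear.
  by exists ([seq (a *: c.1, c.2) | c <- s] ++ s').
have Gtensor x y : G (tensor T x y) (tensor T (S x) y).
  by exists [:: (x, y)]; rewrite /tensor_sum big_seq1 ?S'E.
have G0 : G 0 0 by exists [::]; rewrite /tensor_sum big_nil.
have Gbound p q : G p q -> `|q| <= M * `|p|.
  (* The same orthogonal list represents both [p] and [q], so the squared norms are compared term by
     term. *)
  move=> [s -> ->]; have [t [ot E]] := orthogonalize_legs s; rewrite !E.
  rewrite -(@ler_pXn2r _ 2) ?nnegrE ?mulr_ge0 ?(ltW M0)// exprMn !norm_tensor_sum//.
  rewrite mulr_sumr; apply: ler_sum => c _; rewrite [leRHS]mulrA ler_wpM2r ?exprn_ge0//.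
  by rewrite -exprMn ler_pXn2r ?nnegrE ?mulr_ge0 ?(ltW M0)// S'E.
have Gdense p (e : R[i]) : 0 < e -> exists p' q', G p' q' /\ `|p - p'| < e.
  move=> e0.
  have [|p' [pp' [m [a [v [vT p'E]]]]]] := tensor_total _ (ball_open p e).
    by exists p; exact: ballxx.
  suff [q Gq] : exists q, G p' q.
    by exists p', q; split=> //; move: pp'; rewrite -ball_normE.
  rewrite p'E; elim/big_ind: _ => [|u u' [q Gq] [q' Gq']|i _].
  - by exists 0.
  - by exists (q + q'); have := Glin 1 _ _ _ _ Gq Gq'; rewrite !scale1r.
  - have [x _ [y _ <-]] := vT i.
    exists (a i *: tensor T (S x) y).
    by have := Glin (a i) _ _ _ _ (Gtensor x y) G0; rewrite !addr0.
have [A [lA AM AG]] := dense_extension G0 Glin M0 Gbound Gdense.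
exists A; split=> [|x y]; last exact: AG.
by apply/bounded_operatorP; split=> //; exists M.
Qed.

End TensorId.

(** * The Szego kernel *)

Section Szego.
Variable R : realType.
Local Notation C := (R[i]^o).
Implicit Types z w : C.

(** The partial sums are [(1 - z^n) / (1 - z)], and [z^n] tends to 0 by comparison with the powers
    of the real number [r = |z|]. *)
Lemma cvg_complex_geometric z : `|z| < 1 ->
  series (fun m => z ^+ m : C) @ \oo --> ((1 - z)^-1 : C).
Proof.
move=> z1.
have [r nz] : exists r : R, r%:C = `|z| by exists (complex.Re `|z|); rewrite RRe_real// normr_real.
have z1N : 1 - z != 0.
  by rewrite subr_eq0; apply: contraTneq z1 => <-; rewrite normr1 ltxx.
have zn0 : (fun n => z ^+ n : C) @ \oo --> (0 : C).
  apply/cvgr0Pnorm_lt => e e0.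
  have [d eE] : exists d : R, d%:C = e by exists (complex.Re e); rewrite RRe_real// gtr0_real.
  have r1 : `|r| < 1.
    rewrite ger0_norm -?ltcR -?lecR nz; [exact: z1|exact: normr_ge0].
  have d0 : 0 < d by rewrite -ltcR eE.
  have /cvgr0Pnorm_lt/(_ _ d0) := cvg_expr r1.
  apply: filterS => n rn; rewrite normrX -nz -rmorphXn /= -eE ltcR.
  exact: le_lt_trans (ler_norm _) rn.
have -> : series (fun m => z ^+ m : C) = (fun n => (1 - z)^-1 - (1 - z)^-1 * z ^+ n : C).
  apply/funext => n; rewrite /series /= big_mkord.
  apply: (mulfI z1N); rewrite mulrBr mulrA divff// mul1r.
  by rewrite -[LHS]opprK -mulNr opprB -subrX1 opprB.
suff : (fun n => (1 - z)^-1 - (1 - z)^-1 * z ^+ n : C) @ \oo -->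
    ((1 - z)^-1 - (1 - z)^-1 * 0 : C) by rewrite mulr0 subr0.
by apply: cvgB; [exact: cvg_cst|exact: cvgMl_tmp].
Qed.

Lemma disk_conjM z w : disk z -> disk w -> `|z * w^*| < 1.
Proof.
rewrite /disk /= => z1 w1; rewrite normrM norm_conjC.
by rewrite (le_lt_trans _ z1)// ler_piMr// ltW.
Qed.

Lemma szego_denom_neq0 z w : disk z -> disk w -> 1 - z * w^* != 0.
Proof.
move=> z1 w1; rewrite subr_eq0; apply: contraTneq (disk_conjM z1 w1) => <-.
by rewrite normr1 ltxx.
Qed.

(** Both conditions are geometric series, of ratio [w * w^*] for square-summability and [z * w^*]
    for the values. *)
Lemma hardy_coef_szego w : disk w ->
  hardy_coef (fun m => (w^*) ^+ m : C) (fun z => szego z w).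
Proof.
move=> w1; split=> [|z z1].
  rewrite (_ : (fun m => _) = (fun m => (w * w^*) ^+ m : C)).
    by apply/cvgP/cvg_complex_geometric; exact: disk_conjM.
  by apply/funext => m; rewrite normrX norm_conjC -normCK -!exprM mulnC.
rewrite (_ : (fun m => _) = (fun m => (z * w^*) ^+ m : C)).
  by apply: cvg_complex_geometric; exact: disk_conjM.
by apply/funext => m; rewrite exprMn mulrC.
Qed.

(** The coefficients of the kernel are the powers of [w^*]; conjugated in the inner product, they
    turn it into the power series of [h] at [w]. *)
Lemma szego_reproducing (H2 : hardy_space R) :
  has_reproducing_kernel H2 (@szego R).
Proof.
move=> w w1; have cw := hardy_coef_szego w1.
have [k kE] := (hardyP H2 (fun z => szego z w)).2 (ex_intro _ (fun m => (w^*) ^+ m : C) cw).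
exists k; split=> // h.
have [b hb] := (hardyP H2 (feval H2 h)).1 (ex_intro _ h (fun _ _ => erefl)).
have ck : hardy_coef (fun m => (w^*) ^+ m : C) (feval H2 k).
  by split=> [|z z1]; [exact: cw.1|rewrite kE//; exact: cw.2].
have := inner_hardy ck hb.
rewrite (_ : (fun m => _) = (fun m => b m * w ^+ m : C)); last first.
  by apply/funext => m; rewrite rmorphXn /= conjCK mulrC.
by move=> ikh; apply: (cvg_unique (@norm_hausdorff _ C)) (hb.2 w w1) ikh.
Qed.

End Szego.

(** * Reproducing kernels and the transfer maps *)

Lemma bounded_operator_comp (R : realType) (H K L : hilbertType R)
    (A : K -> L) (B : H -> K) :
  bounded_operator A -> bounded_operator B -> bounded_operator (A \o B).
Proof.
move=> /bounded_operatorP[lA [M M0 AM]] /bounded_operatorP[lB [N N0 BN]].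
apply/bounded_operatorP; split=> [a x y|] /=; first by rewrite lB lA.
exists (M * N) => [|x]; first by rewrite mulr_gt0.
by rewrite (le_trans (AM _))// -mulrA ler_pM2l.
Qed.

Section ReproducingKernel.
Variables (R : realType) (H : function_hilbert R).
Variable K : R[i]^o -> R[i]^o -> R[i]^o.
Hypothesis HK : has_reproducing_kernel H K.
Implicit Types z w : R[i]^o.
Local Notation k := (kernel_at H K).

Lemma kernel_at_reproducing w : disk w ->
  (forall z, disk z -> feval H (k w) z = K z w) /\
  (forall h, feval H h w = inner (k w) h).
Proof.
move=> w1; have [k0 [k0E k0P]] := HK w1.
have kE : forall z, disk z -> feval H (k w) z = K z w.
  by apply: (@xgetPex _ 0 [set k : H | forall z, disk z -> feval H k z = K z w]); exists k0.
suff -> : k w = k0 by [].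
by apply: feval_inj => z z1; rewrite kE// k0E.
Qed.

Lemma inner_kernel w h : disk w -> inner (k w) h = feval H h w.
Proof. by move=> w1; rewrite (kernel_at_reproducing w1).2. Qed.

Lemma inner_kernels z w : disk z -> disk w -> inner (k z) (k w) = K z w.
Proof. by move=> z1 w1; rewrite inner_kernel// (kernel_at_reproducing w1).1. Qed.

Lemma kernel_ext (g h : H) :
  (forall w, disk w -> inner (k w) g = inner (k w) h) -> g = h.
Proof. by move=> gh; apply: feval_inj => w w1; rewrite -!inner_kernel// gh. Qed.

Lemma kernel_isometry (W : hilbertType R) (e : R[i]^o -> W) :
  (forall z w, disk z -> disk w -> inner (e z) (e w) = K z w) ->
  exists V : H -> W, isometry V /\ forall w, disk w -> V (k w) = e w.
Proof.
move=> eK; pose I := {w : R[i]^o | disk w}.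
have [|h kh|V [isoV VE]] := @gram_isometry R H W I (k \o sval) (e \o sval).
- by move=> [z z1] [w w1] /=; rewrite inner_kernels// eK.
- by apply: kernel_ext => w w1; rewrite inner0r; exact: (kh (exist _ w w1)).
- by exists V; split=> // w w1; exact: (VE (exist _ w w1)).
Qed.

(** Kernels are total, and totality is used twice: in [z] to get [S1 = S2] on kernels, then in [w],
    through the adjoints, to reach every vector. *)
Lemma kernel_operator_ext (S1 S2 : H -> H) :
  bounded_operator S1 -> bounded_operator S2 ->
  (forall z w, disk z -> disk w -> inner (k z) (S1 (k w)) = inner (k z) (S2 (k w))) ->
  S1 = S2.
Proof.
move=> b1 b2 E; apply/funext => x; apply: inner_ext => y.
rewrite -!adjointP//; congr inner; apply: kernel_ext => w w1.
rewrite inner_conj [RHS]inner_conj !adjointP//; congr ((inner _ _)^*).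
by apply: kernel_ext => z z1; exact: E.
Qed.

End ReproducingKernel.

Section Transfer.
Variables (R : realType) (phi : R[i]^o -> R[i]^o).
Hypothesis phi_disk : forall z, disk z -> disk (phi z).
Variables (H2 : hardy_space R) (Hphi : dbr_space phi).
Variable T : hilbert_tensor H2 Hphi.
Local Notation k := (kernel_at H2 (@szego R)).
Local Notation c := (kernel_at Hphi (dbr_kernel phi)).

(** The numerator of [dbr_kernel phi] cancels the Szego factor at [phi z], [phi w], so the
    prescribed images have the Szego Gram matrix. *)
Lemma dbr_isometryP : isometry (dbr_isometry T) /\
  forall w, disk w -> dbr_isometry T (k w) = tensor T (k (phi w)) (c w).
Proof.
apply: (@xgetPex _ (fun=> 0) [set V : H2 -> T | isometry V /\
  forall w, disk w -> V (k w) = tensor T (k (phi w)) (c w)]).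
apply: (kernel_isometry (szego_reproducing H2) (e := fun w => tensor T (k (phi w)) (c w))).
move=> z w z1 w1; have phiz1 := phi_disk z1; have phiw1 := phi_disk w1.
rewrite inner_tensor (inner_kernels (szego_reproducing H2))//.
rewrite (inner_kernels (dbr_reproducing Hphi))// /szego /dbr_kernel.
by rewrite mulrA mulVf ?mul1r// szego_denom_neq0.
Qed.

Lemma dbr_cp_map_bounded S :
  bounded_operator S -> bounded_operator (dbr_cp_map T S).
Proof.
move=> bS; have bV := isometry_bounded dbr_isometryP.1.
apply: bounded_operator_comp => //; apply: bounded_operator_comp.
  exact: adjoint_bounded.
exact: (tensor_idP T bS).1.
Qed.

Lemma inner_dbr_cp_map S z w : bounded_operator S -> disk z -> disk w ->
  inner (k z) (dbr_cp_map T S (k w)) =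
  dbr_kernel phi z w * inner (k (phi z)) (S (k (phi w))).
Proof.
move=> bS z1 w1; have [isoV VE] := dbr_isometryP.
rewrite /dbr_cp_map /= inner_conj adjointP; last exact: isometry_bounded.
rewrite -inner_conj !VE// (tensor_idP T bS).2 inner_tensor.
by rewrite (inner_kernels (dbr_reproducing Hphi))// mulrC.
Qed.

End Transfer.

(** * Iterates of [f] and of its transfer map *)

Section Iteration.
Variables (R : realType) (f : R[i]^o -> R[i]^o).
Hypothesis f_disk : forall z, disk z -> disk (f z).
Implicit Types z w : R[i]^o.

Lemma iter_disk n z : disk z -> disk (iter n f z).
Proof. by move=> z1; elim: n => //= n IH; exact: f_disk. Qed.

(** The denominator of the factor of index [n] is the numerator of the kernel of [iter n f]. The
    induction starts at the identity map, whose kernel is 1. *)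
Lemma dbr_kernel_iter n z w : disk z -> disk w ->
  dbr_kernel (iter n f) z w =
  \prod_(0 <= j < n) dbr_kernel f (iter j f z) (iter j f w).
Proof.
move=> z1 w1; elim: n => [|n IH].
  by rewrite big_nil /dbr_kernel /= divff// szego_denom_neq0.
rewrite big_nat_recr//= -IH /dbr_kernel /= [RHS]mulrC mulrA; congr (_ / _).
by rewrite divfK// szego_denom_neq0//; exact: iter_disk.
Qed.

Section CpMap.
Variables (H2 : hardy_space R) (Hf : dbr_space f) (Tf : hilbert_tensor H2 Hf).
Local Notation k := (kernel_at H2 (@szego R)).

Lemma iter_dbr_cp_map_bounded n S :
  bounded_operator S -> bounded_operator (iter n (dbr_cp_map Tf) S).
Proof. by move=> bS; elim: n => //= n IH; exact: dbr_cp_map_bounded. Qed.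

Lemma inner_iter_dbr_cp_map n S z w : bounded_operator S -> disk z -> disk w ->
  inner (k z) (iter n (dbr_cp_map Tf) S (k w)) =
  dbr_kernel (iter n f) z w * inner (k (iter n f z)) (S (k (iter n f w))).
Proof.
move=> bS; elim: n z w => [|n IH] z w z1 w1.
  by rewrite /dbr_kernel /= divff ?mul1r// szego_denom_neq0.
have fz1 := f_disk z1; have fw1 := f_disk w1.
(* Peeling off the outermost map yields the factor of index 0 and moves the points to [f z], [f w];
   the induction hypothesis there supplies the shifted product. *)
rewrite iterS inner_dbr_cp_map//; last exact: iter_dbr_cp_map_bounded.
rewrite IH// -!iterSr mulrA !dbr_kernel_iter// big_nat_recl//=; congr (_ * _ * _).
by apply: eq_bigr => j _; rewrite -!iterSr.
Qed.

End CpMap.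
End Iteration.

Theorem corollary4p9 (R : realType) (f : R[i]^o -> R[i]^o)
    (f_hol : holomorphic_self_map f) (n : nat) (n_gt0 : (0 < n)%N) :
  [/\ (forall z w : R[i]^o, disk z -> disk w ->
         dbr_kernel (iter n f) z w =
         \prod_(0 <= j < n) dbr_kernel f (iter j f z) (iter j f w)),
      (forall (H2 : hardy_space R)
              (Hf : dbr_space f) (Tf : hilbert_tensor H2 Hf)
              (Hfn : dbr_space (iter n f)) (Tfn : hilbert_tensor H2 Hfn)
              (S : H2 -> H2), bounded_operator S ->
         iter n (dbr_cp_map Tf) S = dbr_cp_map Tfn S)
    & (forall (Hf : dbr_space f) (Hfn : dbr_space (iter n f))
              (Tn : hilbert_tensor_power Hf n),
         exists J : Hfn -> Tn, isometry J /\
           forall w : R[i]^o, disk w ->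
             J (kernel_at Hfn (dbr_kernel (iter n f)) w) =
             tensorn Tn [ffun i : 'I_n =>
               kernel_at Hf (dbr_kernel f) (iter (n - i.+1) f w)])].
Proof.
have [f_disk _] := f_hol.
have fn_disk : forall z, disk z -> disk (iter n f z) by move=> z; exact: iter_disk.
split=> [z w|H2 Hf Tf Hfn Tfn S bS|Hf Hfn Tn].
- exact: dbr_kernel_iter.
- apply: (kernel_operator_ext (szego_reproducing H2)).
  + exact: iter_dbr_cp_map_bounded.
  + exact: dbr_cp_map_bounded.
  + by move=> z w z1 w1; rewrite inner_iter_dbr_cp_map// inner_dbr_cp_map.
- pose e w := tensorn Tn [ffun i : 'I_n => kernel_at Hf (dbr_kernel f) (iter (n - i.+1) f w)].
  apply: (@kernel_isometry _ _ _ (dbr_reproducing Hfn) _ e) => z w z1 w1.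
  (* Leg [i] carries the iterate of order [n - (i + 1)], so the index is reversed to match the order
     of the kernel product. *)
  rewrite inner_tensorn dbr_kernel_iter// big_mkord (reindex_inj rev_ord_inj).
  apply: eq_bigr => i _; rewrite !ffunE /= subnSK// subKn ?(ltnW (ltn_ord i))//.
  by rewrite (inner_kernels (dbr_reproducing Hf))//; exact: iter_disk.
Qed.
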